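(* Let $X$ be a uniformly perfect metric space with more than one point, let $\Phi$ be an admissible function, and let $F\subseteq X$ be non-empty and totally bounded. Then $$0\le\dim_{\mathrm H}F\le\underline{\dim}^\Phi F\le\overline{\dim}^\Phi F\le\overline{\dim}_{\mathrm B}F\le\dim_{\mathrm A}F\le\dim_{\mathrm A}X,$$ and $$\underline{\dim}^\Phi F\le\underline{\dim}_{\mathrm B}F\le\overline{\dim}_{\mathrm B}F.$$
   Context: For a subset $U$ of a metric space, $|U|$ denotes its diameter, and $B(x,r)$ is the open ball. Convention: $\inf\varnothing=\infty$; dimensions take values in $[0,\infty]$. A metric space $X$ is uniformly perfect if there is $c\in(0,1)$ such that $B(x,R)\setminus B(x,cR)\neq\varnothing$ for all $x\in X$ and $0<R<|X|$. $N_\delta(F)$ is the smallest number of open balls of radius $\delta/2$ with centres in $F$ needed to cover $F$; $F$ is totally bounded if $N_\delta(F)<\infty$ for all $\delta>0$. A function $\Phi\colon(0,\Delta)\to\mathbb{R}$ (for some $\Delta>0$) is admissible if it is monotonic, $0<\Phi(\delta)\le\delta$ for all $\delta\in(0,\Delta)$, and $\Phi(\delta)/\delta\to0$ as $\delta\to0^+$. For a non-empty totally bounded $F\subseteq X$ and admissible $\Phi$, the upper $\Phi$-intermediate dimension $\overline{\dim}^\Phi F$ is the infimum of all $s\ge0$ such that for all $\epsilon>0$ there exists $\delta_0\in(0,1]$ (with $(0,\delta_0)$ contained in the domain of $\Phi$) such that for all $\delta\in(0,\delta_0)$ there is a finite or countable cover $\{U_1,U_2,\dots\}$ of $F$ by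 subsets of $X$ with $\Phi(\delta)\le|U_i|\le\delta$ for all $i$ and $\sum_i|U_i|^s\le\epsilon$. The lower $\Phi$-intermediate dimension $\underline{\dim}^\Phi F$ is the infimum of all $s\ge0$ such that for all $\epsilon>0$ and $\delta_0\in(0,1]$ there exist $\delta\in(0,\delta_0)$ (in the domain of $\Phi$) and such a cover of $F$ with $\Phi(\delta)\le|U_i|\le\delta$ for all $i$ and $\sum_i|U_i|^s\le\epsilon$. $\dim_{\mathrm H}F$ is the Hausdorff dimension: the infimum of $s\ge0$ such that for all $\epsilon>0$ there is a finite or countable cover $\{U_i\}$ of $F$ with $\sum_i|U_i|^s\le\epsilon$. $\overline{\dim}_{\mathrm B}F$ and $\underline{\dim}_{\mathrm B}F$ are the $\limsup$ and $\liminf$ as $\delta\to0^+$ of $\log N_\delta(F)/(-\log\delta)$. The Assouad dimension $\dim_{\mathrm A}E$ is the infimum of all $a$ for which there exists $C>0$ such that $N_r(B(x,R)\cap E)\le C(R/r)^a$ for all $x\in E$ and $0<r<R$ (so a one-point set has Assouad dimension $0$). *)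

(* Defs.v *)
From HB Require Import structures.
From mathcomp Require Import all_boot all_order all_algebra.
From mathcomp Require Import finmap.
From mathcomp Require Import all_classical all_reals all_analysis.

Set Implicit Arguments.
Unset Strict Implicit.
Unset Printing Implicit Defensive.

Import Order.TTheory GRing.Theory Num.Theory.
Import numFieldNormedType.Exports.

Local Open Scope classical_set_scope.
Local Open Scope ring_scope.
Local Open Scope ereal_scope.

Section MetricNotions.
Context {R : realType} {X : metricType R}.
Implicit Types (U F E : set X).

(* The maximum with 0 only matters for U = set0, where the supremum is -oo. *)
Definition diam U : \bar R :=
  maxe 0 (ereal_sup [set (mdist p.1 p.2)%:E | p in U `*` U]).

(* Since ereal_inf set0 = +oo, the value is +oo when no finite family of balls
   suffices. *)
Definition covering_number (delta : R) F : \bar R :=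
  ereal_inf [set (#|` C|%:R)%:E | C in [set C : {fset X} |
    [set` C] `<=` F /\ F `<=` \bigcup_(x in [set` C]) ball x (delta / 2)%R]].

Definition totally_bounded F : Prop :=
  forall delta : R, (0 < delta)%R -> covering_number delta F < +oo.

(* A finite or countable family {U_1, U_2, ...} is encoded as (U i)_(i in I)
   with I an arbitrary set of indices in nat; a sequence padded with empty sets
   would not do, as the diameters may be required to be bounded below. *)
Definition small_cover F (s eps : R) (P : set (set X)) : Prop :=
  exists (I : set nat) (U : nat -> set X),
    [/\ F `<=` \bigcup_(i in I) U i,
        (forall i, I i -> P (U i)) &
        \esum_(i in I) (diam (U i) `^ s) <= eps%:E].

Definition hausdorff_dim F : \bar R :=
  ereal_inf [set s%:E | s in [set s : R | (0 <= s)%R /\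
    forall eps : R, (0 < eps)%R -> small_cover F s eps setT]].

Definition upper_box_dim F : \bar R :=
  limf_esup (fun delta : R => lne (covering_number delta F) / (- ln delta)%:E)
    0^'+.

Definition lower_box_dim F : \bar R :=
  limf_einf (fun delta : R => lne (covering_number delta F) / (- ln delta)%:E)
    0^'+.

Definition assouad_dim E : \bar R :=
  ereal_inf [set a%:E | a in [set a : R | (0 <= a)%R /\
    exists2 C : R, (0 < C)%R & forall (x : X) (r rho : R), E x ->
      (0 < r)%R -> (r < rho)%R ->
      covering_number r (ball x rho `&` E) <= (C * (rho / r) `^ a)%:E]].

(* Phi is a function on ]0, Delta[; its values elsewhere are never used. *)
Definition upper_Phi_dim (Delta : R) (Phi : R -> R) F : \bar R :=
  ereal_inf [set s%:E | s in [set s : R | (0 <= s)%R /\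
    forall eps : R, (0 < eps)%R ->
      exists delta0 : R, [/\ (0 < delta0)%R, (delta0 <= 1)%R,
        [set` `]0%R, delta0[] `<=` [set` `]0%R, Delta[] &
        forall delta : R, (0 < delta)%R -> (delta < delta0)%R ->
          small_cover F s eps
            [set U | (Phi delta)%:E <= diam U /\ diam U <= delta%:E]]]].

Definition lower_Phi_dim (Delta : R) (Phi : R -> R) F : \bar R :=
  ereal_inf [set s%:E | s in [set s : R | (0 <= s)%R /\
    forall eps delta0 : R, (0 < eps)%R -> (0 < delta0)%R -> (delta0 <= 1)%R ->
      exists delta : R, [/\ (0 < delta)%R, (delta < delta0)%R,
        (delta < Delta)%R &
        small_cover F s eps
          [set U | (Phi delta)%:E <= diam U /\ diam U <= delta%:E]]]].

End MetricNotions.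

Definition uniformly_perfect (R : realType) (X : metricType R) : Prop :=
  exists c : R, [/\ (0 < c)%R, (c < 1)%R &
    forall (x : X) (rho : R), (0 < rho)%R -> rho%:E < diam [set: X] ->
      ball x rho `\` ball x (c * rho)%R !=set0].

Definition admissible (R : realType) (Delta : R) (Phi : R -> R) : Prop :=
  [/\ (0 < Delta)%R,
      {in `]0%R, Delta[ &, {homo Phi : x y / (x <= y)%R}} \/
      {in `]0%R, Delta[ &, {homo Phi : x y /~ (x <= y)%R}},
      forall delta : R, (0 < delta)%R -> (delta < Delta)%R ->
        (0 < Phi delta)%R /\ (Phi delta <= delta)%R &
      (Phi delta / delta)%R @[delta --> 0^'+] --> (0%R : R)].

(* Main.v *)
(* By uniform perfectness a ball of radius d/2 has diameter at least a fixed
   multiple of d, hence at least Phi(d) once d is small, and at most d. So an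
   optimal box-counting cover at scale d is admissible for the
   Phi-intermediate dimensions, and if log N_d(F) / -log d < t < s, then its
   s-cost is at most N_d(F) d^s <= d^(s-t), which tends to 0. The bound by the
   Assouad dimension comes from applying its definition to a single ball
   containing F. *)
Require Import Defs.
From mathcomp Require Import all_boot all_order all_algebra finmap.
From mathcomp Require Import all_classical all_reals all_analysis lra.
Set Implicit Arguments.
Unset Strict Implicit.
Unset Printing Implicit Defensive.

Import Order.TTheory GRing.Theory Num.Theory.
Import numFieldNormedType.Exports.

Local Open Scope classical_set_scope.
Local Open Scope ereal_scope.

(** * Upper and lower limits along a filter *)

Section limf.
Context {T : choiceType} {X : filteredType T} {R : realType}.
Implicit Types (f : X -> \bar R) (G : set_system X) (a : \bar R).

Lemma limf_esup_lt f G a : Filter G -> limf_esup f G < a ->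
  \forall x \near G, f x < a.
Proof.
move=> FG /ereal_inf_lt[_ [V GV <-] Va].
apply: filterS GV => x Vx; apply: le_lt_trans Va.
by apply: ereal_sup_ubound; exists x.
Qed.

(** The lower limit is a supremum of infima over members of [G], so the bound is met inside every
    member, whereas for the upper limit it holds throughout some member. *)
Lemma limf_einf_lt f G a : limf_einf f G < a ->
  forall V, G V -> exists2 x, V x & f x < a.
Proof.
rewrite limf_einfE => ha V GV.
have : ereal_inf (f @` V) < a.
  by apply: le_lt_trans ha; apply: ereal_sup_ubound; exists V.
by move=> /ereal_inf_lt[_ [x Vx <-] xa]; exists x.
Qed.

(** Two members of a proper filter meet, and the value at a common point lies above the infimum over
    one and below the supremum over the other. *)
Lemma limf_einf_le_esup f G : ProperFilter G -> limf_einf f G <= limf_esup f G.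
Proof.
move=> PG; rewrite limf_einfE.
apply: ge_ereal_sup => _ [V GV <-].
apply: le_ereal_inf_tmp => _ [W GW <-].
have [x [Vx Wx]] := filter_ex (filterI GV GW).
apply: (@le_trans _ _ (f x)).
  by apply: ereal_inf_lbound; exists x.
by apply: ereal_sup_ubound; exists x.
Qed.

End limf.

(** * Bounds in the extended reals and behaviour near 0 from the right *)

Section extended_reals.
Context {R : realType}.
Local Open Scope ring_scope.

Lemma lee_gt_EFin (x y : \bar R) :
  (forall t : R, (y < t%:E -> x <= t%:E)%E) -> (x <= y)%E.
Proof.
case: y => [y| |] h; last 2 first.
- by rewrite leey.
- rewrite leeNy_eq; apply/eqP; case: x h => [x| |] //= h.
    have := h (x - 1); rewrite ltNyr lee_fin => /(_ isT) xx; exfalso; lra.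
  by have := h 0; rewrite ltNyr leye_eq => /(_ isT).
apply/lee_addgt0Pr => e e0; apply: h.
by rewrite lte_fin; lra.
Qed.

(** Two thresholds are kept apart: [t] is to bound a box-counting ratio and [s] to be the exponent
    of a cover, with a gap [s - t] to spare. *)
Lemma ereal_inf_le_gt (A : set R) (y : \bar R) :
  (forall t s : R, (y < t%:E)%E -> t < s -> A s) ->
  (ereal_inf [set s%:E | s in A] <= y)%E.
Proof.
move=> h; apply: lee_gt_EFin => t yt; apply: lee_gt_EFin => s.
by rewrite lte_fin => ts; apply: ereal_inf_lbound; exists s => //; apply: h ts.
Qed.

Lemma near_at_right0 (P : R -> Prop) : (\forall x \near 0^'+, P x) ->
  exists2 e : R, 0 < e & forall x, 0 < x -> x < e -> P x.
Proof.
case=> e /= e0 h; exists e => // x x0 xe; apply: h => //=.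
by rewrite sub0r normrN gtr0_norm.
Qed.

Lemma near_powR_le (a eps : R) : 0 < a -> 0 < eps ->
  \forall d \near 0^'+, d `^ a <= eps.
Proof. by move=> a0 e0; apply: (cvgr_le 0) => //; exact: powR_cvg0. Qed.

End extended_reals.

(** * Diameters of balls in a uniformly perfect space *)

Section metric.
Context {R : realType} {X : metricType R}.
Implicit Types (U F E : set X) (x y : X) (r s t d : R).
Local Open Scope ring_scope.

Lemma diam_ge0 U : (0 <= diam U)%E.
Proof. by rewrite /diam le_max lexx. Qed.

Lemma mdist_le_diam {U x y} : U x -> U y -> ((mdist x y)%:E <= diam U)%E.
Proof.
move=> Ux Uy; rewrite /diam le_max; apply/orP; right.
by apply: ereal_sup_ubound; exists (x, y).
Qed.

Lemma diam_ball_le x r : 0 <= r -> (diam (ball x r) <= (2 * r)%:E)%E.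
Proof.
move=> r0; rewrite /diam ge_max lee_fin mulr_ge0//=.
apply: ge_ereal_sup => _ [[y z] /= [xy xz] <-]; rewrite lee_fin.
move: xy xz; rewrite !ballEmdist /= => xy xz.
by have := metric_triangle y x z; rewrite (metric_sym y x); lra.
Qed.

(** Uniform perfectness puts a point of [ball x r] at distance at least [c * r] from [x]. It applies
    once [r] is below the distance of two distinct points, hence below the diameter of the space. *)
Lemma near_diam_ball_ge : uniformly_perfect X -> (exists x y : X, x <> y) ->
  exists2 c : R, 0 < c &
    \forall r \near 0^'+, forall x, ((c * r)%:E <= diam (ball x r))%E.
Proof.
move=> [c [c0 c1 hc]] [x [y xy]]; exists c => //.
have D0 : 0 < mdist x y by rewrite mdist_gt0; apply/eqP.
near=> r => z.
have r0 : 0 < r by near: r; exact: nbhs_right_gt.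
have rD : (r%:E < diam [set: X])%E.
  apply: lt_le_trans (mdist_le_diam (I : [set: X] x) (I : [set: X] y)).
  by rewrite lte_fin; near: r; exact: nbhs_right_lt.
have [w [zw /=]] := hc z r r0 rD.
rewrite {1}ballEmdist /= => /negP; rewrite -leNgt => cr.
apply: le_trans (mdist_le_diam (ballxx z r0) zw).
by rewrite lee_fin.
Unshelve. all: by end_near. Qed.

Lemma near_Phi_le_diam_ball {Delta : R} {Phi} : uniformly_perfect X ->
  (exists x y : X, x <> y) -> admissible Delta Phi ->
  \forall d \near 0^'+, forall x, ((Phi d)%:E <= diam (ball x (d / 2)))%E.
Proof.
move=> up nt [_ _ _ Phi0].
have [c c0 /near_at_right0[e e0 he]] := near_diam_ball_ge up nt.
near=> d => x.
have d0 : 0 < d by near: d; exact: nbhs_right_gt.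
have de : d < e by near: d; exact: nbhs_right_lt.
(* The ball has radius [d / 2], so its diameter is at least [c * (d / 2)]. *)
have Pc : Phi d / d < c / 2.
  by near: d; apply: (cvgr_lt 0) => //; rewrite divr_gt0.
apply: le_trans (he (d / 2) _ _ x); [|lra|lra].
move: Pc; rewrite ltr_pdivrMr// => Pc.
by rewrite lee_fin; lra.
Unshelve. all: by end_near. Qed.

(** * Covering numbers and the cost of box-counting covers *)

Lemma covering_number_ge1 d F : F !=set0 -> (1 <= covering_number d F)%E.
Proof.
move=> [x Fx]; apply: le_ereal_inf_tmp => _ [C [_ FC] <-].
rewrite lee_fin ler1n lt0n; apply/eqP => /cardfs0_eq C0.
by have [y] := FC _ Fx; rewrite C0.
Qed.

(** A non-empty set needs at least one ball, so the logarithm is non-negative and [t] must be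
    positive; exponentiating gives the bound on the count. *)
Lemma box_ratio_lt {d t F} : 0 < d -> d < 1 -> F !=set0 ->
  (lne (covering_number d F) / (- ln d)%:E < t%:E)%E ->
  0 < t /\ (covering_number d F < (d `^ (- t))%:E)%E.
Proof.
move=> d0 d1 F0.
have l0 : 0 < - ln d by rewrite oppr_gt0 ln_lt0// d0.
have := covering_number_ge1 d F0.
rewrite inver gt_eqF// lte_pdivrMr//.
case: (covering_number d F) => [n| |]//=.
rewrite lee_fin => n1; have n0 : 0 < n by apply: lt_le_trans n1.
(* [lne] has a separate branch for [n <= 0], excluded here by [1 <= n]. *)
rewrite leNgt n0/= -EFinM !lte_fin => nt; split.
  by have := le_lt_trans (ln_ge0 n1) nt; rewrite pmulr_lgt0.
by rewrite -ltr_ln ?posrE ?powR_gt0// ln_powR mulNr -mulrN.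
Qed.

(** The balls are indexed by the positions of their centres in [C], so no padding sets arise that
    could violate [P]. A point of [F] serves as the default of [nth]. *)
Lemma finite_ball_cover F (C : {fset X}) r s (P : set (set X)) :
  F !=set0 -> 0 <= r -> 0 <= s ->
  F `<=` \bigcup_(x in [set` C]) ball x r ->
  (forall x, x \in C -> P (ball x r)) ->
  small_cover F s (#|` C|%:R * (2 * r) `^ s) P.
Proof.
move=> [x0 _] r0 s0 FC CP.
exists `I_#|` C|, (fun i => ball (nth x0 C i) r); split.
- move=> y /FC[x /= Cx xy]; exists (index x C) => /=.
    by rewrite index_mem.
  by rewrite nth_index.
- by move=> i /= iC; apply: CP; rewrite mem_nth.
have dge0 i : (0 <= diam (ball (nth x0 C i) r) `^ s)%E by apply: poweR_ge0.
rewrite esum_fset//.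
rewrite -fsbig_ord/= EFinM.
apply: (@le_trans _ _ (\sum_(i < #|` C|) ((2 * r) `^ s)%:E)%E).
  apply: lee_sum => i _; rewrite -poweR_EFin.
  apply: gt0_ler_poweR => //; rewrite ?in_itv/= ?leey ?andbT//.
  - exact: diam_ge0.
  - by rewrite lee_fin mulr_ge0.
  - exact: diam_ball_le.
by rewrite sumEFin lee_fin sumr_const card_ord -[leLHS]mulr_natl.
Qed.

(** Fewer than [d]^ (- t)[balls of radius]d / 2[suffice, each of cost at most]d [^ s]; [s] is
    non-negative because [0 < t < s]. *)
Lemma box_ratio_small_cover d t s F (P : set (set X)) : 0 < d -> d < 1 ->
  F !=set0 -> t < s ->
  (lne (covering_number d F) / (- ln d)%:E < t%:E)%E ->
  (forall x, P (ball x (d / 2))) ->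
  small_cover F s (d `^ (s - t)) P.
Proof.
move=> d0 d1 F0 ts /(box_ratio_lt d0 d1 F0)[t0].
move=> /ereal_inf_lt[_ [C [_ FC] <-]]; rewrite lte_fin => Ct Pball.
have d20 : 0 <= d / 2 by lra.
have s0 : 0 <= s by lra.
have [I [U [FU PU sU]]] := finite_ball_cover F0 d20 s0 FC (fun x _ => Pball x).
exists I, U; split => //; apply: le_trans sU _.
rewrite lee_fin mulrCA divff// mulr1 powRB ?gt_eqF ?implybT//.
by rewrite mulrC ler_wpM2l ?powR_ge0// -powRN ltW.
Qed.

(** * Hausdorff and intermediate dimensions *)

Lemma hausdorff_dim_ge0 F : (0 <= hausdorff_dim F)%E.
Proof. by apply: le_ereal_inf_tmp => _ [s [s0 _] <-]; rewrite lee_fin. Qed.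

Lemma hausdorff_le_lower_Phi Delta Phi F :
  (hausdorff_dim F <= lower_Phi_dim Delta Phi F)%E.
Proof.
apply: ereal_inf_le_tmp => _ [s [s0 hs] <-]; exists s => //.
split=> // eps eps0.
(* A cover at one scale is enough, so [delta0] is taken to be 1 and the diameter bounds are
   forgotten. *)
have [d [_ _ _ [I [U [FU _ sU]]]]] := hs eps 1 eps0 ltr01 (lexx _).
by exists I, U; split.
Qed.

Lemma lower_Phi_le_upper_Phi Delta Phi F :
  (lower_Phi_dim Delta Phi F <= upper_Phi_dim Delta Phi F)%E.
Proof.
apply: ereal_inf_le_tmp => _ [s [s0 hs] <-]; exists s => //.
split=> // eps e eps0 e0 _.
have [d [d0 _ dDelta hd]] := hs eps eps0.
(* Half of this minimum is a scale strictly below both thresholds, and thus in the domain of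
   [Phi]. *)
have m0 : 0 < Order.min d e by rewrite lt_min d0.
have [md me] : Order.min d e <= d /\ Order.min d e <= e.
  by rewrite !ge_min !lexx orbT.
have md' : Order.min d e / 2 < d by lra.
exists (Order.min d e / 2); split; [lra|lra| |by apply: hd => //; lra].
have : (Order.min d e / 2) \in `]0, Delta[.
  by apply: dDelta; rewrite /= in_itv/= md'; lra.
by rewrite in_itv => /andP[].
Qed.

(** Shared by both box dimensions: the ratio bound stays a premise inside the limit, since it holds
    eventually in one case and only frequently in the other. *)
Lemma near_box_ratio_small_cover Delta Phi F t s eps :
  uniformly_perfect X -> (exists x y : X, x <> y) -> admissible Delta Phi ->
  F !=set0 -> t < s -> 0 < eps ->
  \forall d \near 0^'+,
    (lne (covering_number d F) / (- ln d)%:E < t%:E)%E ->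
    small_cover F s eps
      [set U | ((Phi d)%:E <= diam U)%E /\ (diam U <= d%:E)%E].
Proof.
move=> up nt adm F0 ts eps0; near=> d => dt.
have d0 : 0 < d by near: d; exact: nbhs_right_gt.
have d1 : d < 1 by near: d; exact: nbhs_right_lt.
have Pball x : ((Phi d)%:E <= diam (ball x (d / 2)))%E /\
    (diam (ball x (d / 2)) <= d%:E)%E.
  (* [x] is generalised first, as the threshold on [d] must be uniform over all centres. *)
  split; first by move: x; near: d; exact: near_Phi_le_diam_ball adm.
  by rewrite (le_trans (diam_ball_le _ _))// ?lee_fin; lra.
have [I [U [FU PU sU]]] := box_ratio_small_cover (P :=
  [set U | ((Phi d)%:E <= diam U)%E /\ (diam U <= d%:E)%E])
  d0 d1 F0 ts dt Pball.
exists I, U; split=> //; apply: le_trans sU _; rewrite lee_fin.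
by near: d; apply: near_powR_le => //; rewrite subr_gt0.
Unshelve. all: by end_near. Qed.

(** * Intermediate dimensions against box dimensions *)

Section Phi_box.
Variables (Delta : R) (Phi : R -> R) (F : set X).
Hypotheses (up : uniformly_perfect X) (nt : exists x y : X, x <> y).
Hypotheses (adm : admissible Delta Phi) (F0 : F !=set0).

Lemma upper_Phi_le_upper_box : (upper_Phi_dim Delta Phi F <= upper_box_dim F)%E.
Proof.
apply: ereal_inf_le_gt => t s /limf_esup_lt Ft ts; split=> [|eps eps0].
  (* A single scale in []0, 1[] with ratio below [t] already forces [0 < t < s]. *)
  have /filter_ex[d [[d0 d1] dt]] : \forall d \near 0^'+, (0 < d /\ d < 1) /\
      (lne (covering_number d F) / (- ln d)%:E < t%:E)%E.
    apply: filterI => //; apply: filterI; first exact: nbhs_right_gt.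
    exact: nbhs_right_lt.
  by have [t0 _] := box_ratio_lt d0 d1 F0 dt; lra.
have [e e0 he] : exists2 e, 0 < e &
    forall d, 0 < d -> d < e -> small_cover F s eps
      [set U | ((Phi d)%:E <= diam U)%E /\ (diam U <= d%:E)%E].
  apply: near_at_right0.
  have := near_box_ratio_small_cover up nt adm F0 ts eps0.
  by apply: filterS2 Ft => d dt; apply.
have [Delta0 _ _ _] := adm.
(* [e] ensures the covers, 1 is the cap in the definition and [Delta] bounds the domain of [Phi]. *)
exists (Order.min e (Order.min 1 Delta)); split.
- by rewrite !lt_min e0 ltr01.
- by rewrite !ge_min lexx orbT.
- move=> d /=; rewrite !in_itv/= => /andP[->].
  by rewrite !lt_min => /and3P[_ _ ->].
- by move=> d d0; rewrite lt_min => /andP[de _]; exact: he.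
Qed.

Lemma lower_Phi_le_lower_box : (lower_Phi_dim Delta Phi F <= lower_box_dim F)%E.
Proof.
apply: ereal_inf_le_gt => t s /limf_einf_lt Ft ts.
have small (e : R) : 0 < e -> \forall d \near 0^'+, 0 < d /\ d < e.
  by move=> e0; apply: filterI; [exact: nbhs_right_gt|exact: nbhs_right_lt].
split=> [|eps e eps0 e0 _].
  have [d [d0 d1] dt] := Ft _ (small _ ltr01).
  by have [t0 _] := box_ratio_lt d0 d1 F0 dt; lra.
have [Delta0 _ _ _] := adm.
(* The three conditions hold for all small [d], so the lower limit supplies a scale satisfying them
   together with the ratio bound. *)
have [d [[d0 de] [[_ dDelta] hd]] dt] := Ft _ (filterI (small e e0) (filterI
  (small Delta Delta0) (near_box_ratio_small_cover up nt adm F0 ts eps0))).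
by exists d; split=> //; exact: hd.
Qed.

End Phi_box.

(** * Assouad dimension *)

Lemma totally_bounded_ball F : F !=set0 -> totally_bounded F ->
  exists x r, [/\ F x, 0 < r & F `<=` ball x r].
Proof.
move=> [x Fx] /(_ 2 ltac:(lra))/ereal_inf_lt[_ [C [_ FC] _] _].
(* At scale 2 the covering balls have radius 1; the sum dominates the distance from [x] to each
   centre. *)
exists x, (1 + \sum_(y <- C) mdist x y); split=> //.
  by rewrite ltr_pwDl// sumr_ge0// => y _; exact: mdist_ge0.
move=> z /FC[y /= Cy]; rewrite !ballEmdist/= divff// => yz.
apply: le_lt_trans (metric_triangle x y z) _.
rewrite addrC ltr_leD// (big_rem y)//= lerDl sumr_ge0// => w _.
exact: mdist_ge0.
Qed.

Lemma covering_number_subset_half d E F : 0 < d -> E `<=` F ->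
  (covering_number d E <= covering_number (d / 2) F)%E.
Proof.
move=> d0 EF; apply: le_ereal_inf_tmp => _ [C [_ FC] <-].
pose g x := xget x (ball x (d / 2 / 2) `&` E).
(* Centres may lie outside [E]: replace them by points of [E] in the same balls,
   at the cost of doubling the radius. *)
pose C' := (g @` [fset x in C | `[< ball x (d / 2 / 2) `&` E !=set0 >]])%fset.
apply: (@le_trans _ _ (#|` C'|%:R)%:E).
  apply: ereal_inf_lbound; exists C' => //; split.
    move=> z /= /imfsetP[x /=]; rewrite !inE/= => /andP[_ /asboolP[y xy]] ->.
    by have [] := xgetPex x (ex_intro _ y xy).
  move=> y Ey; have [x /= Cx xy] := FC _ (EF _ Ey).
  have ne : (ball x (d / 2 / 2) `&` E) !=set0 by exists y.
  exists (g x).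
    by apply/imfsetP; exists x => //; rewrite !inE/= Cx; apply/asboolP.
  have [xg _] := xgetPex x ne.
  (* Both [g x] and [y] lie within [d / 4] of [x], hence within [d / 2] of each other. *)
  exact: (@ball_splitr _ _ x) xg xy.
rewrite lee_fin ler_nat (leq_trans (leq_imfset_card _ _ _))//.
by apply: (fsubset_leq_card (fset_sub _ _)).
Qed.

Lemma assouad_dim_mono E F : E `<=` F -> (assouad_dim E <= assouad_dim F)%E.
Proof.
move=> EF; apply: ereal_inf_le_tmp => _ [a [a0 [C C0 hC]] <-]; exists a => //.
split=> //; exists (C * 2 `^ a); first by rewrite mulr_gt0 ?powR_gt0.
move=> x r rho Ex r0 rrho.
apply: (@le_trans _ _ (covering_number (r / 2) (ball x rho `&` F))).
  by apply: covering_number_subset_half => //; exact: setIS.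
have r20 : 0 < r / 2 by lra.
have r2rho : r / 2 < rho by lra.
apply: le_trans (hC x _ _ (EF _ Ex) r20 r2rho) _.
rewrite lee_fin -mulrA -powRM//; last by rewrite divr_ge0; lra.
by rewrite invfM invrK (mulrA rho) (mulrC (rho / r)).
Qed.

Lemma upper_box_le_assouad F : F !=set0 -> totally_bounded F ->
  (upper_box_dim F <= assouad_dim F)%E.
Proof.
move=> F0 /(totally_bounded_ball F0)[x [rho [Fx rho0 Frho]]].
apply: le_ereal_inf_tmp => _ [a [a0 [C C0 hC]] <-].
have FE : ball x rho `&` F = F by apply/setIidr.
apply/lee_addgt0Pr => e e0; rewrite -EFinD.
(* With [rho] fixed, the Assouad bound reads [ln N <= K + a * - ln d], and [K] is absorbed by
   [e * - ln d] as [d] tends to 0. *)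
pose K := ln C + a * ln rho.
have near_le : \forall d \near 0^'+,
    (lne (covering_number d F) / (- ln d)%:E <= (a + e)%:E)%E.
  near=> d.
  have d0 : 0 < d by near: d; exact: nbhs_right_gt.
  have d1 : d < 1 by near: d; exact: nbhs_right_lt.
  have drho : d < rho by near: d; exact: nbhs_right_lt.
  have l0 : 0 < - ln d by rewrite oppr_gt0 ln_lt0// d0.
  have Kd : K <= e * - ln d.
    (* At this threshold [e * - ln d] equals [K]. *)
    have : d < expR (- (K / e)).
      by near: d; apply: nbhs_right_lt; exact: expR_gt0.
    rewrite -[X in X < _]lnK ?posrE// ltr_expR ltrNr ltr_pdivrMr// mulrC.
    by move=> /ltW; lra.
  rewrite inver gt_eqF// lee_pdivrMr//.
  have := hC x d rho Fx d0 drho; rewrite FE.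
  have := covering_number_ge1 d F0.
  case: (covering_number d F) => [n| |]//=; rewrite !lee_fin => n1 nC.
  have n0 : 0 < n by apply: lt_le_trans n1.
  rewrite [n <= 0]leNgt n0/= -EFinM lee_fin.
  have rd0 : 0 < rho / d by rewrite divr_gt0.
  have : ln n <= ln (C * (rho / d) `^ a).
    by rewrite ler_ln ?posrE ?mulr_gt0 ?powR_gt0.
  rewrite lnM ?posrE ?powR_gt0// ln_powR ln_div ?posrE// => /le_trans; apply.
  by rewrite /K in Kd; lra.
(* The set of scales where the bound holds belongs to the filter, so the supremum over it bounds the
   upper limit. *)
apply: (@le_trans _ _ (ereal_sup [set
    (lne (covering_number d F) / (- ln d)%:E)%E | d in
    [set d | (lne (covering_number d F) / (- ln d)%:E <= (a + e)%:E)%E]])).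
  by apply: ereal_inf_lbound; eexists; first exact: near_le.
by apply: ge_ereal_sup => _ [d dae <-].
Unshelve. all: by end_near. Qed.

End metric.

Theorem proposition3p1 (R : realType) (X : metricType R)
    (Xperfect : uniformly_perfect X) (Xnontrivial : exists x y : X, x <> y)
    (Delta : R) (Phi : R -> R) (Phi_adm : admissible Delta Phi)
    (F : set X) (F0 : F !=set0) (Ftb : totally_bounded F) :
  [/\ 0 <= hausdorff_dim F /\ hausdorff_dim F <= lower_Phi_dim Delta Phi F,
      lower_Phi_dim Delta Phi F <= upper_Phi_dim Delta Phi F,
      upper_Phi_dim Delta Phi F <= upper_box_dim F,
      upper_box_dim F <= assouad_dim F &
      assouad_dim F <= assouad_dim [set: X]] /\
  (lower_Phi_dim Delta Phi F <= lower_box_dim F /\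
   lower_box_dim F <= upper_box_dim F).
Proof.
split; [split|split].
- by split; [exact: hausdorff_dim_ge0|exact: hausdorff_le_lower_Phi].
- exact: lower_Phi_le_upper_Phi.
- exact: upper_Phi_le_upper_box.
- exact: upper_box_le_assouad.
- exact: assouad_dim_mono.
- exact: lower_Phi_le_lower_box.
- exact: limf_einf_le_esup.
Qed.
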